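(* Let $\mathcal{C}$ be some set of varieties, and let $\mathcal{C}'\subset\mathcal{C}$. Suppose that for any $X\in\mathcal{C}$ and for any finite group $G\subset\operatorname{Aut}(X)$ there is a variety $X'\in\mathcal{C}'$ with $G\subset\operatorname{Aut}(X')$ and a $G$-equivariant surjective morphism $X'\to X$. Then $\mathcal{C}$ has almost fixed points if and only if $\mathcal{C}'$ does.
   Context: All varieties are over an algebraically closed field of characteristic $0$. A set $\mathcal{C}$ of varieties is said to have almost fixed points if there is a constant $J=J(\mathcal{C})$ such that for any variety $X\in\mathcal{C}$ and for any finite subgroup $G\subset\operatorname{Aut}(X)$ there exists a subgroup $F\subset G$ of index at most $J$ acting on $X$ with a fixed point. *)

(* Defs.v *)
From HB Require Import structures.
From mathcomp Require Import all_boot all_order all_algebra all_fingroup.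
From mathcomp Require Import boolp classical_sets functions.
From mathcomp Require Import topology.
From mathcomp Require Import -(notations) mpoly.

Set Implicit Arguments.
Unset Strict Implicit.
Unset Printing Implicit Defensive.

Import GRing.Theory.
Local Open Scope classical_set_scope.
Local Open Scope ring_scope.

(* Varieties are treated classically: a variety is the set of its closed points,
   with the Zariski topology and the sheaf of k-valued regular functions
   (Mumford, Red Book, I.4-I.6). In particular a fixed point is a closed point. *)

(* The sections of the sheaf over an open set U are functions on U; they are
   represented by total functions X -> k whose values outside U are irrelevant.
   For such a sheaf, locality gives the gluing axiom. *)
Record funSpace (k : fieldType) : Type := FunSpace {
  fs_space :> topologicalType;
  regular : set fs_space -> set (fs_space -> k);
  regular_eq : forall (U : set fs_space) (f g : fs_space -> k), open U ->
    {in U, f =1 g} -> regular U f -> regular U g;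
  regular_sub : forall (U V : set fs_space) (f : fs_space -> k),
    open U -> open V -> V `<=` U -> regular U f -> regular V f;
  regular_local : forall (U : set fs_space) (f : fs_space -> k), open U ->
    (forall x, U x ->
       exists V : set fs_space, [/\ open V, V x, V `<=` U & regular V f]) ->
    regular U f;
  regular_cst : forall (U : set fs_space) (c : k), open U ->
    regular U (fun=> c);
  regularD : forall (U : set fs_space) (f g : fs_space -> k), open U ->
    regular U f -> regular U g -> regular U (fun x => f x + g x);
  regularM : forall (U : set fs_space) (f g : fs_space -> k), open U ->
    regular U f -> regular U g -> regular U (fun x => f x * g x)
}.

Definition is_morphism (k : fieldType) (X Y : funSpace k) (f : X -> Y) : Prop :=
  continuous f /\
  forall (V : set Y) (g : Y -> k), open V -> regular V g ->
    regular (f @^-1` V) (g \o f).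

Definition is_open_immersion (k : fieldType) (X Y : funSpace k) (f : X -> Y) :
    Prop :=
  [/\ injective f,
      forall W : set X, open W <-> open (f @` W) &
      forall (W : set X) (g : Y -> k), open W ->
        regular (f @` W) g <-> regular W (g \o f)].

Section AffineAlgebraicSets.
Variables (k : fieldType) (n : nat).
Local Notation polys := (mpoly n k).
Local Notation "p .@[ v ]" := (meval v p)
  (at level 2, format "p .@[ v ]").

Record algSet (S : set polys) : Type := AlgSet {
  alg_pt :> 'I_n -> k;
  alg_ptP : forall p : polys, S p -> p.@[alg_pt] = 0
}.

Variable S : set polys.
Local Notation A := (algSet S).

HB.instance Definition _ := gen_eqMixin (algSet S).
HB.instance Definition _ := gen_choiceMixin (algSet S).

Definition zariski_open (U : set A) : Prop :=
  exists I : set polys, U = [set x : A | exists2 p, I p & p.@[x] != 0].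

Let zariski_openT : zariski_open setT.
Proof.
exists setT; apply/seteqP; split=> // x _; exists 1 => //.
by rewrite meval1 oner_neq0.
Qed.

Let zariski_openI : setI_closed zariski_open.
Proof.
move=> _ _ [I ->] [J ->].
exists [set r | exists p q, [/\ I p, J q & r = p * q]].
apply/seteqP; split=> x /=.
  move=> [[p Ip px] [q Jq qx]]; exists (p * q); first by exists p, q.
  by rewrite mevalM mulf_neq0.
move=> [r [p [q [Ip Jq ->]]]]; rewrite mevalM mulf_eq0 negb_or.
by move=> /andP[px qx]; split; [exists p | exists q].
Qed.

Let zariski_open_bigU (T : Type) (F : T -> set A) :
  (forall i, zariski_open (F i)) -> zariski_open (\bigcup_i F i).
Proof.
move=> /choice[I FI]; exists (\bigcup_i I i).
apply/seteqP; split=> x /=.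
  by move=> [i _]; rewrite FI => -[p Ip px]; exists p => //; exists i.
by move=> [p [i _ Ip] px]; exists i => //; rewrite FI; exists p.
Qed.

HB.instance Definition _ := isOpenTopological.Build (algSet S)
  zariski_openT zariski_openI zariski_open_bigU.

Definition alg_regular (U : set A) (f : A -> k) : Prop :=
  forall x, U x -> exists (V : set A) (p q : polys),
    [/\ open V, V x, V `<=` U &
        forall y, V y -> q.@[y] != 0 /\ f y = p.@[y] / q.@[y]].

Let alg_regular_eq (U : set A) (f g : A -> k) : open U ->
  {in U, f =1 g} -> alg_regular U f -> alg_regular U g.
Proof.
move=> _ fg Uf x /Uf[V [p [q [oV Vx VU fE]]]]; exists V, p, q; split=> // y Vy.
by rewrite -fg; [exact: fE | exact/mem_set/VU].
Qed.

Let alg_regular_sub (U V : set A) (f : A -> k) :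
  open U -> open V -> V `<=` U -> alg_regular U f -> alg_regular V f.
Proof.
move=> _ oV VU Uf x Vx; have [W [p [q [oW Wx WU fE]]]] := Uf x (VU _ Vx).
exists (W `&` V), p, q; split=> //; first exact: openI.
by move=> y [Wy _]; exact: fE.
Qed.

Let alg_regular_local (U : set A) (f : A -> k) : open U ->
  (forall x, U x ->
     exists V : set A, [/\ open V, V x, V `<=` U & alg_regular V f]) ->
  alg_regular U f.
Proof.
move=> _ Uf x /Uf[V [oV Vx VU /(_ x Vx)[W [p [q [oW Wx WV fE]]]]]].
by exists W, p, q; split=> //; exact: subset_trans VU.
Qed.

Let alg_regular_cst (U : set A) (c : k) : open U -> alg_regular U (fun=> c).
Proof.
move=> oU x Ux; exists U, (mpolyC n c), 1; split=> // y _.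
by rewrite mevalC meval1 oner_neq0 divr1.
Qed.

Let alg_regularD (U : set A) (f g : A -> k) : open U ->
  alg_regular U f -> alg_regular U g -> alg_regular U (fun x => f x + g x).
Proof.
move=> _ Uf Ug x Ux.
have [V [p [q [oV Vx VU fE]]]] := Uf x Ux.
have [W [r [s [oW Wx WU gE]]]] := Ug x Ux.
exists (V `&` W), (p * s + r * q), (q * s); split=> //; first exact: openI.
  by move=> y [/VU].
move=> y [/fE[q0 ->] /gE[s0 ->]].
by rewrite mevalD !mevalM mulf_neq0 // addf_div.
Qed.

Let alg_regularM (U : set A) (f g : A -> k) : open U ->
  alg_regular U f -> alg_regular U g -> alg_regular U (fun x => f x * g x).
Proof.
move=> _ Uf Ug x Ux.
have [V [p [q [oV Vx VU fE]]]] := Uf x Ux.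
have [W [r [s [oW Wx WU gE]]]] := Ug x Ux.
exists (V `&` W), (p * r), (q * s); split=> //; first exact: openI.
  by move=> y [/VU].
move=> y [/fE[q0 ->] /gE[s0 ->]].
by rewrite !mevalM mulf_neq0 // mulf_div.
Qed.

Definition affine_algebraic_set : funSpace k :=
  FunSpace alg_regular_eq alg_regular_sub alg_regular_local
    alg_regular_cst alg_regularD alg_regularM.

End AffineAlgebraicSets.

Definition irreducible_space (X : topologicalType) : Prop :=
  [set: X] !=set0 /\
  forall A B : set X, closed A -> closed B -> A `|` B = setT ->
    A = setT \/ B = setT.

(* The charts need not be assumed irreducible: nonempty open subsets of an
   irreducible space are. *)
Definition is_prevariety (k : fieldType) (X : funSpace k) : Prop :=
  irreducible_space X /\
  exists (m : nat) (n : 'I_m -> nat)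
      (S : forall i : 'I_m, set (mpoly (n i) k))
      (phi : forall i : 'I_m, affine_algebraic_set (S i) -> X),
    (forall i, is_open_immersion (phi i)) /\
    (forall x : X, exists (i : 'I_m) (a : affine_algebraic_set (S i)),
       phi i a = x).

(* Mumford's form of the closed diagonal condition, Red Book, I.6: the equalizer
   of any two morphisms from a prevariety is closed. *)
Definition is_separated (k : fieldType) (X : funSpace k) : Prop :=
  forall (Y : funSpace k) (f g : Y -> X), is_prevariety Y ->
    is_morphism f -> is_morphism g -> closed [set y | f y = g y].

Record variety (k : closedFieldType) : Type := Variety {
  var_space :> funSpace k;
  var_prevariety : is_prevariety var_space;
  var_separated : is_separated var_space
}.

Section AutomorphismGroup.
Variables (k : fieldType).

Record autType (X : funSpace k) : Type := MkAut {
  aut_fun :> X -> X;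
  aut_inv : X -> X;
  aut_funK : cancel aut_fun aut_inv;
  aut_invK : cancel aut_inv aut_fun;
  aut_fun_morphism : is_morphism aut_fun;
  aut_inv_morphism : is_morphism aut_inv
}.

Variable X : funSpace k.

Lemma aut_eq (a b : autType X) : a =1 b -> a = b.
Proof.
case: a b => [f f' fK f'K mf mf'] [g g' gK g'K mg mg'] /= /funext fg.
subst g; have fg' : f' = g'.
  by apply/funext => x; rewrite -{1}(g'K x) fK.
subst g'; rewrite (Prop_irrelevance fK gK) (Prop_irrelevance f'K g'K).
by rewrite (Prop_irrelevance mf mg) (Prop_irrelevance mf' mg').
Qed.

Lemma is_morphism_id : is_morphism (@id X).
Proof. by split=> // x; exact: cvg_id. Qed.

Lemma is_morphism_comp (Y Z W : funSpace k) (g : Z -> W) (f : Y -> Z) :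
  is_morphism g -> is_morphism f -> is_morphism (g \o f).
Proof.
move=> [cg rg] [cf rf]; split.
  by move=> x; apply: continuous_comp; [exact: cf | exact: cg].
move=> V h oV hV; apply: (rf (g @^-1` V) (h \o g)); last exact: rg.
by apply: open_comp => // x _; exact: cg.
Qed.

HB.instance Definition _ := gen_eqMixin (autType X).
HB.instance Definition _ := gen_choiceMixin (autType X).

Definition aut_one : autType X :=
  @MkAut X id id (fun=> erefl) (fun=> erefl) is_morphism_id is_morphism_id.

Definition aut_mul (a b : autType X) : autType X :=
  @MkAut X (a \o b) (aut_inv b \o aut_inv a)
    (can_comp (aut_funK a) (aut_funK b)) (can_comp (aut_invK b) (aut_invK a))
    (is_morphism_comp (aut_fun_morphism a) (aut_fun_morphism b))
    (is_morphism_comp (aut_inv_morphism b) (aut_inv_morphism a)).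

Definition aut_V (a : autType X) : autType X :=
  MkAut (aut_invK a) (aut_funK a) (aut_inv_morphism a) (aut_fun_morphism a).

Let aut_mulA : associative aut_mul.
Proof. by move=> a b c; exact: aut_eq. Qed.
Let aut_mul1 : left_id aut_one aut_mul.
Proof. by move=> a; exact: aut_eq. Qed.
Let aut_mulr1 : right_id aut_one aut_mul.
Proof. by move=> a; exact: aut_eq. Qed.
Let aut_mulV : left_inverse aut_one aut_V aut_mul.
Proof. by move=> a; apply: aut_eq => x /=; rewrite aut_funK. Qed.
Let aut_mulrV : right_inverse aut_one aut_V aut_mul.
Proof. by move=> a; apply: aut_eq => x /=; rewrite aut_invK. Qed.

HB.instance Definition _ := isGroup.Build (autType X)
  aut_mulA aut_mul1 aut_mulr1 aut_mulV aut_mulrV.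

End AutomorphismGroup.

(* An inclusion G \subset Aut(X) of a finite group is given by a finite group G
   together with an injective homomorphism rho : G -> Aut(X). A set of varieties
   is a predicate: variety k lies above the universe of classical_sets.set. *)
Definition almost_fixed_points (k : closedFieldType) (C : variety k -> Prop) :
    Prop :=
  exists J : nat, forall X : variety k, C X ->
    forall (G : finGroupType) (rho : {multiplicative G -> autType X}),
      injective rho ->
      exists F : {group G}, (#|[set: G]%G : F|%g <= J)%N /\
        exists x : X, forall g : G, g \in F -> rho g x = x.

(* Main.v *)
Require Import Defs.
From HB Require Import structures.
From mathcomp Require Import all_boot all_order all_algebra all_fingroup.
From mathcomp Require Import boolp classical_sets functions topology.

Local Open Scope classical_set_scope.
Local Open Scope ring_scope.

Theorem lemma4p4 (k : closedFieldType) (char0 : [pchar k] =i pred0)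
    (C C' : variety k -> Prop) (subC : forall X : variety k, C' X -> C X)
    (equivariant_cover : forall X : variety k, C X ->
       forall (G : finGroupType) (rho : {multiplicative G -> autType X}),
         injective rho ->
         exists X' : variety k, C' X' /\
           exists (rho' : {multiplicative G -> autType X'}) (f : X' -> X),
             [/\ injective rho', is_morphism f, (forall x, exists x', f x' = x)
               & forall (g : G) (x' : X'), f (rho' g x') = rho g (f x')]) :
  almost_fixed_points C <-> almost_fixed_points C'.
Proof.
split=> -[J hJ]; exists J => X CX G rho rho_inj.
  (* A bound valid for all of [C] is in particular valid on the subset [C']. *)
  exact: hJ (subC _ CX) _ _ rho_inj.
(* Conversely, the bound for [C'] is applied to a cover [X'] of [X]. The same group [G] acts
   faithfully on both, so the index of the subgroup [F] found upstairs is unchanged and the constant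
   [J] carries over. *)
have [X' [CX' [rho' [f [rho'_inj _ _ f_equiv]]]]] :=
  equivariant_cover _ CX _ _ rho_inj.
have [F [indexF [x' fix_x']]] := hJ _ CX' _ _ rho'_inj.
(* An equivariant map sends fixed points to fixed points: for [g] in [F],
   [rho g (f x') = f (rho' g x') = f x']. *)
by exists F; split=> //; exists (f x') => g gF; rewrite -f_equiv fix_x'.
Qed.
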